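(* Let $a,b\in\mathbb{Q}$ with $b\neq 0$, and let $p\in\mathbb{Q}$ with $p>0$ and $\sqrt p\notin\mathbb{Q}$. Let $\alpha=\sqrt[3]{a+b\sqrt p}$, and set $N=a^2-b^2p$ and $R(x)=x^3-3Nx-2aN\in\mathbb{Q}[x]$. Then there exist $A,B\in\mathbb{Q}$ with $\alpha=A+B\sqrt p$ if and only if $N$ is the cube of a rational number and $R(x)$ is reducible over $\mathbb{Q}$. Furthermore, in this case $R(x)$ has a unique rational root $r$, and $A$ and $B$ are given by $$A=\frac{r}{2\sqrt[3]{N}}\qquad\text{and}\qquad B=\frac{b\sqrt[3]{N^2}}{r^2-N}.$$
   Context: For a real number $t$, $\sqrt[3]{t}$ denotes its unique real cube root, and $\sqrt p$ denotes the positive square root. *)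

(* Defs.v *)
From mathcomp Require Import all_boot all_order all_algebra.
From mathcomp Require Import ring lra.
From mathcomp Require Import classical_sets reals.

Set Implicit Arguments.
Unset Strict Implicit.
Unset Printing Implicit Defensive.
Import Order.TTheory GRing.Theory Num.Theory.
Local Open Scope ring_scope.
Local Open Scope classical_set_scope.

(* By cbrtK and cbrt_unique, the default value of xget is never used. *)
Definition cbrt (R : realType) (t : R) : R := xget 0 [set x : R | x ^+ 3 = t].

Lemma cbrtK (R : realType) (t : R) : cbrt t ^+ 3 = t.
Proof.
apply: (@xgetPex _ 0 [set x : R | x ^+ 3 = t]).
set c := `|t| + 1.
have ht := ler_norm t; have ht' := ler_norm (- t); rewrite normrN in ht'.
have n0 := normr_ge0 t.
have c1 : 1 <= c by rewrite /c; lra.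
have c3 : c <= c ^+ 3 by rewrite -[leLHS]expr1 ler_weXn2l.
have [|/=|x _ /rootP] := @poly_ivt _ ('X^3 - t%:P) (- c) c.
- lra.
- rewrite !hornerE; rewrite /c in c3 *; apply/andP; split; lra.
by rewrite !hornerE => /eqP; rewrite subr_eq0 => /eqP; exists x.
Qed.

Lemma cbrt_unique (R : realType) (x t : R) : x ^+ 3 = t -> x = cbrt t.
Proof.
rewrite -{1}(cbrtK t); move: (cbrt t) => y h.
apply/eqP; rewrite -subr_eq0 -sqrf_eq0; apply/eqP.
have e : (x - y) * (x ^+ 2 + x * y + y ^+ 2) = 0.
  have -> : (x - y) * (x ^+ 2 + x * y + y ^+ 2) = x ^+ 3 - y ^+ 3 by ring.
  by rewrite h subrr.
move/eqP: e; rewrite mulf_eq0 => /orP[/eqP ->|/eqP e]; first by rewrite expr0n.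
nra.
Qed.

(* Main.v *)
Require Import Defs.
From mathcomp Require Import all_boot all_order all_algebra.
From mathcomp Require Import ring lra.
From mathcomp Require Import boolp classical_sets reals.
Set Implicit Arguments.
Unset Strict Implicit.
Unset Printing Implicit Defensive.
Import Order.TTheory GRing.Theory Num.Theory.
Local Open Scope ring_scope.

(** Write [s] for the square root of [p], so that [1] and [s] are linearly
independent over the rationals, and [N = a ^+ 2 - b ^+ 2 p] for the norm of
[a + b s].

If [(A + B s) ^+ 3 = a + b s], then comparing coefficients gives
[a = A ^+ 3 + 3 A B ^+ 2 p] and [b = B (3 A ^+ 2 + B ^+ 2 p)].  Multiplying
by the conjugate equation gives [N = (A ^+ 2 - B ^+ 2 p) ^+ 3]; with
[n = A ^+ 2 - B ^+ 2 p], eliminating [B] from the formula for [a] leaves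
[4 A ^+ 3 - 3 n A - a = 0], whose left side is the value of the resolvent cubic
['X^3 - 3 N 'X - 2 a N] at [r = 2 n A], divided by [2 N].

Conversely, when [N = n ^+ 3], a rational root [r] of this cubic gives
[A = r / (2 n)] with [a = 4 A ^+ 3 - 3 n A].  Everything then rests on the identity
[(4 A ^+ 3 - 3 n A) ^+ 2 - n ^+ 3 = (A ^+ 2 - n) (4 A ^+ 2 - n) ^+ 2]
(the Chebyshev relation [cos^2 - 1 = - sin^2] for the tripled angle): its left
side is [b ^+ 2 p], so [B = b / (4 A ^+ 2 - n)] satisfies
[B ^+ 2 p = A ^+ 2 - n], and then [A + B s] is a cube root of [a + b s]
([cube_of_root]).

So each rational root [r] produces a representation of alpha whose first
coefficient is [r / (2 n)] ([representation_of_root]).  By linear independence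
alpha has only one representation ([sqrt_indep]); this gives at once the
uniqueness of [r] and the formulas for [A] and [B]. *)

Lemma sqrt_indep (R : realType) (p A B A' B' : rat) :
    irrational (Num.sqrt (ratr p : R)) ->
    ratr A + ratr B * Num.sqrt (ratr p) =
      ratr A' + ratr B' * Num.sqrt (ratr p) :> R ->
  A = A' /\ B = B'.
Proof.
move=> irr; set s := Num.sqrt _ in irr *; move=> e.
have eB : B = B'.
  apply/eqP; rewrite -subr_eq0; apply/negP => /negP nz.
  have nz' : ratr B - ratr B' != 0 :> R by rewrite -rmorphB /= fmorph_eq0.
  apply: irr; exists ((A' - A) / (B - B')) => //.
  rewrite fmorph_div !rmorphB /=.
  apply: (mulIf nz'); rewrite divfK //; lra.
by split=> //; apply: (fmorph_inj (@ratr R)); move: e; rewrite eB => /addIr.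
Qed.

(** A vanishing norm would make [p] the square of [a / b]. *)
Lemma norm_neq0 (R : realType) (a b p : rat) :
    b != 0 -> irrational (Num.sqrt (ratr p : R)) ->
  a ^+ 2 - b ^+ 2 * p != 0.
Proof.
move=> hb irr; apply/eqP => N0; apply: irr; exists `|a / b| => //.
have -> : p = (a / b) ^+ 2.
  apply: (mulfI (expf_neq0 2 hb)); rewrite -exprMn [b * _]mulrC divfK //; lra.
by rewrite rmorphXn /= sqrtr_sqr ratr_norm.
Qed.

Definition resolvent (a N : rat) : {poly rat} :=
  'X^3 - (3 * N) *: 'X - (2 * a * N)%:P.

Lemma root_resolvent a N r :
  root (resolvent a N) r = (r ^+ 3 - 3 * N * r - 2 * a * N == 0).
Proof. by rewrite rootE !hornerE. Qed.

Lemma size_resolvent a N : size (resolvent a N) = 4%N.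
Proof.
rewrite /resolvent -addrA size_polyDl size_polyXn // -opprD size_polyN.
rewrite (leq_ltn_trans (size_polyD _ _)) // gtn_max.
rewrite (leq_ltn_trans (size_scale_leq _ _)) ?size_polyX //.
by rewrite (leq_ltn_trans (size_polyC_leq1 _)).
Qed.

(** The degree being three, a proper factorization has a linear factor. *)
Lemma resolvent_reducible a N :
  ~ irreducible_poly (resolvent a N) <-> exists r, root (resolvent a N) r.
Proof.
split=> [nirr|[r rr] [_ irr]].
  apply: contrapT => nroot; apply: nirr; apply: cubic_irreducible.
    by rewrite size_resolvent.
  by move=> x; apply/negP => rx; apply: nroot; exists x.
have /(irr _ _)/eqp_size : 'X - r%:P %| resolvent a N by rewrite dvdp_XsubCl.
by rewrite size_XsubC size_resolvent => /(_ isT).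
Qed.

(** Cubing both sides and using the independence of [1] and [sqrt p]. *)
Lemma cube_coeffs (R : realType) (a b p A B : rat) :
    0 < p -> irrational (Num.sqrt (ratr p : R)) ->
    cbrt (ratr a + ratr b * Num.sqrt (ratr p)) =
      ratr A + ratr B * Num.sqrt (ratr p) :> R ->
  a = A ^+ 3 + 3 * A * B ^+ 2 * p /\ b = B * (3 * A ^+ 2 + B ^+ 2 * p).
Proof.
move=> hp irr e; apply: (sqrt_indep irr).
have sK : Num.sqrt (ratr p : R) ^+ 2 = ratr p by rewrite sqr_sqrtr // ler0q ltW.
rewrite -[LHS]cbrtK e !(rmorphD, rmorphM, rmorphXn, ratr_nat) /=.
by move: (Num.sqrt _) sK => s <-; ring.
Qed.

(** With [r = 2 n A], the denominator of [B] is [n ^+ 2 (4 A ^+ 2 - n)], so that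
[B = b / (4 A ^+ 2 - n)].  The tripling identity [key] gives both that this
denominator is nonzero, since [b ^+ 2 p] is, and that [B ^+ 2 p = A ^+ 2 - n];
the two equations then reduce to polynomial identities in [A] and [n]. *)
Lemma cube_of_root (a b p n r : rat) :
    b != 0 -> 0 < p -> n != 0 -> a ^+ 2 - b ^+ 2 * p = n ^+ 3 ->
    r ^+ 3 - 3 * n ^+ 3 * r - 2 * a * n ^+ 3 = 0 ->
    let A := r / (2 * n) in let B := b * n ^+ 2 / (r ^+ 2 - n ^+ 3) in
  a = A ^+ 3 + 3 * A * B ^+ 2 * p /\ b = B * (3 * A ^+ 2 + B ^+ 2 * p).
Proof.
move=> hb hp hn hN hr A B.
have n30 : n ^+ 3 != 0 by rewrite expf_neq0.
have bp0 : b ^+ 2 * p != 0 by rewrite mulf_neq0 ?expf_neq0 // gt_eqF.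
have rA : r = 2 * n * A by rewrite /A; field.
have aA : a = 4 * A ^+ 3 - 3 * n * A.
  apply: (mulfI n30); apply: (@mulfI _ 2) => //.
  have -> : 2 * (n ^+ 3 * a) = r ^+ 3 - 3 * n ^+ 3 * r by lra.
  rewrite rA; ring.
have key : b ^+ 2 * p = (A ^+ 2 - n) * (4 * A ^+ 2 - n) ^+ 2.
  have -> : b ^+ 2 * p = a ^+ 2 - n ^+ 3 by lra.
  by rewrite aA; ring.
have d0 : 4 * A ^+ 2 - n != 0.
  by apply: contra_neq bp0 => d0; rewrite key d0 expr0n mulr0.
have BE : B = b / (4 * A ^+ 2 - n).
  have dE : r ^+ 2 - n ^+ 3 = n ^+ 2 * (4 * A ^+ 2 - n) by rewrite rA; ring.
  by rewrite /B dE; field; rewrite hn d0.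
have B2p : B ^+ 2 * p = A ^+ 2 - n.
  have -> : B ^+ 2 * p = b ^+ 2 * p / (4 * A ^+ 2 - n) ^+ 2.
    by rewrite BE; field.
  by rewrite key mulfK // expf_neq0.
split; first by rewrite -mulrA B2p aA; ring.
by rewrite B2p BE; field.
Qed.

Lemma representation_of_root (R : realType) (a b p n r : rat) :
    b != 0 -> 0 < p -> n != 0 -> a ^+ 2 - b ^+ 2 * p = n ^+ 3 ->
    r ^+ 3 - 3 * n ^+ 3 * r - 2 * a * n ^+ 3 = 0 ->
  cbrt (ratr a + ratr b * Num.sqrt (ratr p)) =
    ratr (r / (2 * n)) + ratr (b * n ^+ 2 / (r ^+ 2 - n ^+ 3))
                         * Num.sqrt (ratr p) :> R.
Proof.
move=> hb hp hn hN hr; apply/esym/cbrt_unique.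
have [] := cube_of_root hb hp hn hN hr.
set A := r / _; set B := _ / (_ - _) => -> ->.
have sK : Num.sqrt (ratr p : R) ^+ 2 = ratr p by rewrite sqr_sqrtr // ler0q ltW.
rewrite !(rmorphD, rmorphM, rmorphXn, ratr_nat) /=.
by move: (Num.sqrt _) sK => s <-; ring.
Qed.

Theorem theorem1p1 (R : realType) (a b p : rat)
    (hb : b != 0) (hp : 0 < p) (hirr : irrational (Num.sqrt (ratr p : R))) :
  let sqrtp : R := Num.sqrt (ratr p) in
  let alpha : R := cbrt (ratr a + ratr b * sqrtp) in
  let N : rat := a ^+ 2 - b ^+ 2 * p in
  let Rx : {poly rat} := 'X^3 - (3 * N) *: 'X - (2 * a * N)%:P in
  let representable := exists A B : rat, alpha = ratr A + ratr B * sqrtp in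
  (representable <->
     (exists n : rat, N = n ^+ 3) /\ ~ irreducible_poly Rx) /\
  (representable ->
     (exists! r : rat, root Rx r) /\
     forall r A B : rat,
       root Rx r -> alpha = ratr A + ratr B * sqrtp ->
       ratr A = ratr r / (2 * cbrt (ratr N)) :> R /\
       ratr B = ratr b * cbrt (ratr N ^+ 2) / (ratr r ^+ 2 - ratr N) :> R).
Proof.
move=> s alpha N Rx representable.
have N0 : N != 0 := norm_neq0 a hb hirr.
have n0 n : N = n ^+ 3 -> n != 0.
  by move=> e; apply: contra_neq N0 => n0; rewrite e n0 expr0n.
have cube_root : representable ->
    exists n, N = n ^+ 3 /\ exists r, root Rx r.
  move=> [A [B e]]; have [eA eB] := cube_coeffs hp hirr e.
  pose n := A ^+ 2 - B ^+ 2 * p.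
  have hN : N = n ^+ 3 by rewrite /N eA eB /n; ring.
  exists n; split=> //; exists (2 * n * A).
  by rewrite root_resolvent hN eA /n; apply/eqP; ring.
have root_repr n r : N = n ^+ 3 -> root Rx r -> alpha =
    ratr (r / (2 * n)) + ratr (b * n ^+ 2 / (r ^+ 2 - n ^+ 3)) * s.
  move=> hN; rewrite root_resolvent => /eqP; rewrite hN => hr.
  exact: representation_of_root (n0 _ hN) hN hr.
split; first split.
- move=> /cube_root[n [hN hr]]; split; first by exists n.
  exact/resolvent_reducible.
- move=> [[n hN] /resolvent_reducible[r hr]].
  by do 2 eexists; exact: root_repr hN hr.
move=> /cube_root[n [hN [r hr]]]; split.
  exists r; split=> // r' hr'.
  have [e _] := sqrt_indep hirr
    (etrans (esym (root_repr n r hN hr)) (root_repr n r' hN hr')).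
  by apply: (mulIf _ e); rewrite invr_eq0 mulf_neq0 ?(n0 _ hN).
move=> r' A B hr' e.
have [-> ->] := sqrt_indep hirr (etrans (esym e) (root_repr n r' hN hr')).
have -> : cbrt (ratr N : R) = ratr n.
  by apply/esym/cbrt_unique; rewrite hN rmorphXn.
have -> : cbrt (ratr N ^+ 2 : R) = ratr n ^+ 2.
  by apply/esym/cbrt_unique; rewrite hN rmorphXn /= exprAC.
by rewrite hN !(fmorph_div, rmorphB, rmorphXn, rmorphM) /= ratr_nat.
Qed.
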